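(* Let $n\ge 2$, $d\ge 1$, $\tau>0$, $\sigma>0$. Let $\mu^\star_1,\mu^\star_2\stackrel{\mathrm{i.i.d.}}{\sim}\mathcal N(0,\tau^2 I_d)$ and $\xi_1,\dots,\xi_n\stackrel{\mathrm{i.i.d.}}{\sim}\mathcal N(0,\sigma^2 I_d)$, independent, let $z^\star_1,\dots,z^\star_n\in\{1,2\}$ be fixed labels with both classes nonempty, and $x_i=\mu^\star_{z^\star_i}+\xi_i$. Let $\{C_1,C_2\}$ be a fixed partition of $[n]$ into two nonempty sets with centroids $\widehat\mu_j=|C_j|^{-1}\sum_{k\in C_j}x_k$. Fix $i\in[n]$, let $j$ be such that $i\in C_j$, $\overline j$ the other index, and $c=|C_j|$, $\bar c=|C_{\overline j}|$. If $$\sigma>\frac{\sqrt{2\bar c}\,\tau\,(c-1)}{\sqrt{c(c+\bar c)}},$$ then $$\mathbb P\bigl(\|x_i-\widehat\mu_{\overline j}\|^2<\|x_i-\widehat\mu_j\|^2\bigr)\le\rho^{d/4},$$ where $$\rho=\frac{4\sigma^2(c-1)c^2\bar c(\bar c+1)\bigl(c(\sigma^2+2\tau^2)-2\tau^2\bigr)}{\bigl(-c(\sigma^2+4\tau^2)\bar c+c^2(\sigma^2+2(\sigma^2+\tau^2)\bar c)+2\tau^2\bar c\bigr)^2},$$ and $0\le\rho<1$.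
   Context: $[n]=\{1,\dots,n\}$. Randomness is only over the centers $\mu^\star_\ell$ and the noise $\xi_i$; the labels $z^\star$ and the partition $\{C_1,C_2\}$ are deterministic. *)

(* Defs.v *)
From HB Require Import structures.
From mathcomp Require Import all_boot all_order all_algebra.
From mathcomp Require Import all_classical all_reals all_analysis.
Set Implicit Arguments. Unset Strict Implicit. Unset Printing Implicit Defensive.
Import Order.TTheory GRing.Theory Num.Theory.
Local Open Scope classical_set_scope.
Local Open Scope ring_scope.

Definition mutually_independent {dT : measure_display} {T : measurableType dT}
  {R : realType} (P : probability T R) {I : finType} (X : I -> T -> R) : Prop :=
  forall (J : {set I}) (B : I -> set R), (forall i, measurable (B i)) ->
    P (\bigcap_(i in [set i | i \in J]) (X i @^-1` B i)) =
    (\prod_(i in J) fine (P (X i @^-1` B i)))%:E.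

(* X has law N(m, s^2) (s = standard deviation). *)
Definition has_normal_law {dT : measure_display} {T : measurableType dT}
  {R : realType} (P : probability T R) (X : T -> R) (m s : R) : Prop :=
  forall A : set R, measurable A -> P (X @^-1` A) = normal_prob m s A.

Definition sqdist {R : realType} {d : nat} (u v : 'I_d -> R) : R :=
  \sum_(k < d) (u k - v k) ^+ 2.

Definition centroid {R : realType} {n d : nat} (C : 'I_n -> 'I_2) (j : 'I_2)
  (x : 'I_n -> 'I_d -> R) : 'I_d -> R :=
  fun k => (#|[pred m | C m == j]|%:R)^-1 * \sum_(m < n | C m == j) x m k.

Definition other (j : 'I_2) : 'I_2 := if j == ord0 then ord_max else ord0.

Definition rho34 {R : realType} (sigma tau c cb : R) : R :=
  (4 * sigma ^+ 2 * (c - 1) * c ^+ 2 * cb * (cb + 1)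
     * (c * (sigma ^+ 2 + 2 * tau ^+ 2) - 2 * tau ^+ 2))
  / (- c * (sigma ^+ 2 + 4 * tau ^+ 2) * cb
     + c ^+ 2 * (sigma ^+ 2 + 2 * (sigma ^+ 2 + tau ^+ 2) * cb)
     + 2 * tau ^+ 2 * cb) ^+ 2.

(* Main.v *)
Require Import Defs.
From HB Require Import structures.
From mathcomp Require Import all_boot all_order all_algebra.
From mathcomp Require Import all_classical all_reals all_analysis.
From mathcomp Require Import measurable_realfun ring lra.
Import Order.TTheory GRing.Theory Num.Theory.
Local Open Scope classical_set_scope.
Local Open Scope ring_scope.

(* Each coordinate of A = x_i - mu_jb and of B = x_i - mu_j is a linear
   combination of the independent Gaussians, and its noise variance depends only
   on the cluster sizes. The centers can only help A, so Var A_k >=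
   VA = sigma^2 (1 + 1/cb), and they hurt B most when x_i is alone in its class
   within its cluster, so Var B_k <= VB = 2 tau^2 (1 - 1/c)^2 + sigma^2 (1 - 1/c).
   The separation hypothesis says VB < VA, and rho = 4 VA VB / (VA + VB)^2.
   By Chernoff and Cauchy-Schwarz, P(|A|^2 < |B|^2) is at most
   (E exp(2s|B|^2) E exp(-2s|A|^2))^(1/2)
     <= ((1 - 4s VB) (1 + 4s VA))^(-d/4),
   and the best s gives rho^(d/4). The exponential moments are computed by
   integrating out the Gaussian variables one at a time. *)

(** * Gaussian integrals in one variable *)

(** The density [normal_pdf m s] is almost everywhere the Radon-Nikodym derivative of
    [normal_prob m s], since both have the same integral over every measurable set; the rest is a
    change of variables. *)
Lemma ge0_integral_normal_prob (R : realType) (m s : R) (f : R -> \bar R) :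
  measurable_fun setT f -> (forall x, (0 <= f x)%E) ->
  (\int[normal_prob m s]_x f x =
   \int[lebesgue_measure]_x (f x * (normal_pdf m s x)%:E))%E.
Proof.
move=> mf f0.
have dom := normal_prob_dominates m s.
rewrite -(Radon_Nikodym_SigmaFinite.change_of_variables dom)//.
apply: ae_eq_integral => //.
- apply: emeasurable_funM => //.
  exact: measurable_int (Radon_Nikodym_SigmaFinite.f_integrable dom).
- apply: emeasurable_funM => //=.
  by apply/measurableT_comp => //; exact: measurable_normal_pdf.
- apply: ae_eqe_mul2l => /=; apply: integral_ae_eq => //=.
  + exact: Radon_Nikodym_SigmaFinite.f_integrable.
  + by apply/measurableT_comp => //; exact: measurable_normal_pdf.
  + by move=> E _ mE; rewrite -Radon_Nikodym_SigmaFinite.f_integral.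
Qed.

(* Completing the square turns the integrand into a multiple of another normal
   density, whose total mass is 1. *)
Lemma integral_normal_prob_expR_sqr (R : realType) (s t a y : R) :
  0 < s -> 0 < 1 + 2 * t * (a * s) ^+ 2 ->
  (\int[normal_prob 0 s]_x (expR (- (t * (a * x + y) ^+ 2)))%:E =
   ((Num.sqrt (1 + 2 * t * (a * s) ^+ 2))^-1 *
     expR (- (t / (1 + 2 * t * (a * s) ^+ 2) * y ^+ 2)))%:E)%E.
Proof.
move=> s0 q0; set q := (1 + 2 * t * (a * s) ^+ 2) in q0 *.
have sq0 : 0 < Num.sqrt q by rewrite sqrtr_gt0.
have s'0 : 0 < s / Num.sqrt q by rewrite divr_gt0.
have s'2 : (s / Num.sqrt q) ^+ 2 = s ^+ 2 / q.
  by rewrite expr_div_n sqr_sqrtr// ltW.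
(* In the combined exponent [x] has precision [q / s ^+ 2] and linear term [- 2 t a y x], so the new
   density has mean [m] and variance [s ^+ 2 / q]. *)
pose m := - (2 * t * a * y * (s ^+ 2 / q)).
rewrite ge0_integral_normal_prob//; last first.
  apply/measurable_EFinP; apply: measurableT_comp => //.
  apply: measurableT_comp => //; apply: measurable_funM => //.
  by apply: measurable_funX; apply: measurable_funD.
under eq_integral => x _.
  rewrite -EFinM (_ : _ * _ = ((Num.sqrt q)^-1 * expR (- (t / q * y ^+ 2))) *
     normal_pdf m (s / Num.sqrt q) x); last first.
    rewrite !normal_pdfE ?gt_eqF// /normal_peak /normal_fun s'2.
    rewrite -[s ^+ 2 * pi *+ 2]mulr_natr -[s ^+ 2 / q * pi *+ 2]mulr_natr.
    have -> : s ^+ 2 / q * pi * 2 = (s ^+ 2 * pi * 2) / q :> R by field; rewrite gt_eqF.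
    have sp : 0 <= s ^+ 2 * pi * 2 by do 2?apply: mulr_ge0 => //; rewrite ?sqr_ge0 ?pi_ge0.
    rewrite [Num.sqrt (_ / q)]sqrtrM// sqrtrV ?ltW// invfM invrK.
    set p := (Num.sqrt (s ^+ 2 * pi * 2))^-1.
    rewrite [LHS]mulrCA -expRD -[RHS]mulrA [X in _ = _ * X]mulrCA -expRD.
    rewrite [RHS]mulrA; congr (_ * expR _).
      by rewrite [RHS]mulrCA mulVf ?gt_eqF// mulr1.
    rewrite /m /q; field.
    by rewrite -/q !gt_eqF.
  over.
have c0 : 0 <= (Num.sqrt q)^-1 * expR (- (t / q * y ^+ 2)).
  by rewrite mulr_ge0 ?expR_ge0// invr_ge0 ltW.
under eq_integral do rewrite EFinM.
rewrite ge0_integralZl//=; last 2 first.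
- by apply/measurableT_comp => //; exact: measurable_normal_pdf.
- by move=> x _; rewrite lee_fin normal_pdf_ge0.
by rewrite integral_normal_pdf mule1.
Qed.

(** * Independence and integrating out one variable *)

(** These sets are closed under intersection and generate the sigma-algebra of the variables indexed
    by [J]; they have the very shape on which [mutually_independent] gives a product. *)
Definition cylinders {dT : measure_display} {T : measurableType dT}
  {R : realType} {I : finType} (X : I -> T -> R) (J : {set I}) : set (set T) :=
  [set E | exists2 B : I -> set R, (forall i, measurable (B i)) &
     E = \bigcap_(i in [set i | i \in J]) (X i @^-1` B i)].

Lemma measurable_fun_cylinders (dT : measure_display) (T : measurableType dT)
  (R : realType) (I : finType) (X : I -> T -> R) (J : {set I}) (s : I) :
  s \in J ->
  measurable_fun setT (X s : g_sigma_algebraType (cylinders X J) -> R).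
Proof.
move=> sJ _ B mB; rewrite setTI; apply: sub_sigma_algebra.
exists (fun i => if i == s then B else setT) => [i|]; first by case: ifP.
apply/seteqP; split => [w Bw i _|w /(_ s sJ)]; rewrite /= ?eqxx//.
by case: eqP => // ->.
Qed.

(** Uniqueness of measures: as functions of [E], both sides are finite measures, and they agree on
    the cylinders over [J], a generating class closed under intersection. *)
Lemma mutually_independent_cylinders (dT : measure_display)
  (T : measurableType dT) (R : realType) (P : probability T R) (I : finType)
  (X : I -> T -> R) (J : {set I}) (s : I) (A : set R) (E : set T) :
  (forall i, measurable_fun setT (X i)) -> mutually_independent P X ->
  s \notin J -> measurable A -> <<s cylinders X J >> E ->
  P (X s @^-1` A `&` E) = (P (X s @^-1` A) * P E)%E.
Proof.
move=> mX indX sJ mA JE.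
have mXA : measurable (X s @^-1` A) by rewrite -[_ @^-1` _]setTI; exact: mX.
pose r : {nonneg R} := NngNum (fine_ge0 (measure_ge0 P (X s @^-1` A))).
have PE : P (X s @^-1` A) = r%:num%:E by rewrite /= fineK ?fin_num_measure.
rewrite PE setIC.
apply: (@g_sigma_algebra_measure_unique _ _ _ (cylinders X J) _ (fun _ => setT)
  _ _ (mrestr P mXA) (mscale r P)) => //.
- move=> _ [B mB ->]; apply: fin_bigcap_measurable; first exact: finite_finpred.
  by move=> i _; rewrite -[_ @^-1` _]setTI; exact: mX.
- move=> _; exists (fun=> setT) => //.
  by apply/seteqP; split.
- by rewrite bigcup_const//; exists 0%N.
- move=> _ _ [B mB ->] [C mC ->]; exists (fun i => B i `&` C i).
    by move=> i; exact: measurableI.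
  by rewrite -bigcapI.
- move=> _ [B mB ->]; rewrite -[LHS]/(P (_ `&` _)) -[RHS]/(r%:num%:E * P _)%E -PE setIC.
  (* Since [s] is outside [J], prescribing [A] at [s] leaves the constraints over [J] intact, and
     the intersection becomes a single cylinder over [J] enlarged by [s]. *)
  pose BA i := if i == s then A else B i.
  have mBA i : measurable (BA i) by rewrite /BA; case: ifP.
  have BAE i : i \in J -> BA i = B i.
    by rewrite /BA; case: eqP => // ->; rewrite (negbTE sJ).
  have -> : X s @^-1` A `&` \bigcap_(i in [set i | i \in J]) X i @^-1` B i =
      \bigcap_(i in [set i | i \in (s |: J)%SET]) X i @^-1` BA i.
    rewrite -(@eq_bigcapr _ _ _ (fun i => X i @^-1` BA i)); last first.
      by move=> i iJ; rewrite BAE.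
    have -> : X s @^-1` A = X s @^-1` BA s by rewrite /BA eqxx.
    rewrite -(bigcap_setU1 (fun i => X i @^-1` BA i)); apply: eq_bigcapl.
    by split=> i /=; [case=> [->|iJ]; rewrite in_setU1 ?eqxx ?iJ ?orbT
      |rewrite in_setU1 => /orP[/eqP ->|]; [left|right]].
  rewrite indX// indX// big_setU1//= EFinM.
  have -> : BA s = A by rewrite /BA eqxx.
  rewrite fineK ?fin_num_measure//.
  by congr (_ * _%:E)%E; apply: eq_bigr => i iJ; rewrite BAE.
- by move=> _; rewrite -[X in (X < _)%E]/(P (_ `&` _)) setTI ltey_eq fin_num_measure.
Qed.

(** The product formula on rectangles identifies the joint law of [X] and [Y] as the product of [N]
    and the law of [Y]; Tonelli does the rest. *)
Lemma integral_indep_pair (dT d1 d2 : measure_display)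
  (T : measurableType dT) (T1 : measurableType d1) (T2 : measurableType d2)
  (R : realType) (P : probability T R) (N : probability T1 R)
  (X : T -> T1) (Y : T -> T2) (f : T1 * T2 -> \bar R) :
  measurable_fun setT X -> measurable_fun setT Y ->
  (forall A B, measurable A -> measurable B ->
    P (X @^-1` A `&` Y @^-1` B) = N A * P (Y @^-1` B))%E ->
  measurable_fun setT f -> (forall u, 0 <= f u)%E ->
  (\int[P]_w f (X w, Y w) = \int[P]_w \int[N]_x f (x, Y w))%E.
Proof.
move=> mX mY XY mf f0.
have mXY : measurable_fun setT (fun w => (X w, Y w)) by exact: measurable_fun_pair.
pose mY' : {mfun T >-> T2} := HB.pack Y (isMeasurableFun.Build _ _ _ _ Y mY).
pose PY : probability T2 R := distribution P mY'.
transitivity (\int[N \x PY]_u f u)%E.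
  rewrite -[LHS](@ge0_integral_pushforward _ _ _ _ _ _ mXY P setT f)//.
  apply: eq_measure_integral => A mA _; apply/esym.
  by apply: (@product_measure_unique _ _ _ _ _ N PY) => // B C mB mC; exact: XY.

rewrite fubini_tonelli2//.
rewrite -[RHS](@ge0_integral_pushforward _ _ _ _ _ _ mY P setT
  (fun y => \int[N]_x f (x, y))%E)//.
- exact: measurable_fun_fubini_tonelli_G.
- by move=> y _; exact: integral_ge0.
Qed.

(** [U] carries the factors that do not involve [X]. After the Gaussian integral the integrand keeps
    its shape, without [X] and with a rescaled [t], so the step can be iterated. *)
Lemma integral_integrate_out (dT : measure_display) (T : measurableType dT)
  (R : realType) (P : probability T R) (X Y U : T -> R) (s a t : R) :
  measurable_fun setT X -> measurable_fun setT Y -> measurable_fun setT U ->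
  (forall w, 0 <= U w) -> 0 < s -> 0 < 1 + 2 * t * (a * s) ^+ 2 ->
  (forall A (B : set (R * R)), measurable A -> measurable B ->
    P (X @^-1` A `&` (fun w => (Y w, U w)) @^-1` B) =
    normal_prob 0 s A * P ((fun w => (Y w, U w)) @^-1` B))%E ->
  (\int[P]_w (expR (- (t * (a * X w + Y w) ^+ 2)) * U w)%:E =
   ((Num.sqrt (1 + 2 * t * (a * s) ^+ 2))^-1)%:E *
   \int[P]_w (expR (- (t / (1 + 2 * t * (a * s) ^+ 2) * Y w ^+ 2)) * U w)%:E)%E.
Proof.
move=> mX mY mU U0 s0 q0 XYU.
set q := 1 + _ in q0 *.
have mYU : measurable_fun setT (fun w => (Y w, U w)) by exact: measurable_fun_pair.
(* The absolute value makes [f] nonnegative everywhere, as Tonelli requires; on the values of [U] it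
   changes nothing. *)
pose f (u : R * (R * R)) : \bar R :=
  (expR (- (t * (a * u.1 + u.2.1) ^+ 2)) * `|u.2.2|)%:E.
have mf : measurable_fun setT f.
  apply/measurable_EFinP; apply: measurable_funM; last first.
    by apply: measurableT_comp => //; apply: measurableT_comp.
  apply: measurableT_comp => //; apply: measurableT_comp => //.
  apply: measurable_funM => //; apply: measurable_funX; apply: measurable_funD.
    exact: measurable_funM.
  exact: measurableT_comp.
have := @integral_indep_pair _ _ _ _ _ _ _ P (normal_prob 0 s) X _ f mX mYU XYU mf.
move=> /(_ (fun u => _)) IP.
transitivity (\int[P]_w f (X w, (Y w, U w)))%E.
  by apply: eq_integral => w _; rewrite /f /= ger0_norm.
rewrite IP; last by move=> u; rewrite lee_fin mulr_ge0 ?expR_ge0.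
rewrite -ge0_integralZl//; last 2 first.
- apply/measurable_EFinP; apply: measurable_funM => //.
  apply: measurableT_comp => //; apply: measurableT_comp => //.
  by apply: measurable_funM => //; exact: measurable_funX.
- by move=> w _; rewrite lee_fin mulr_ge0 ?expR_ge0.
apply: eq_integral => w _; rewrite /f /=.
under eq_integral do rewrite EFinM muleC.
rewrite ge0_integralZl//=.
- rewrite integral_normal_prob_expR_sqr//.
  by rewrite ger0_norm// -!EFinM -/q; congr _%:E; ring.
- apply/measurable_EFinP; apply: measurableT_comp => //.
  apply: measurableT_comp => //; apply: measurable_funM => //.
  by apply: measurable_funX; apply: measurable_funD.
Qed.

(** * Exponential moments of sums of squares of Gaussian linear forms *)

Section quadratic_forms.
Context {dT : measure_display} {T : measurableType dT} {R : realType}.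
Context (P : probability T R) {I K : finType} (X : I -> T -> R).
Context (a sd : I -> R) (kap : I -> K).

(** [kap] sorts the variables into blocks, one linear form per block, so that distinct forms share
    no variable. The list [r] of variables still present lets an induction remove them one at a
    time. *)
Definition lcomb (r : seq I) (k : K) (w : T) : R :=
  \sum_(i <- r) (kap i == k)%:R * (a i * X i w).

(** For a duplicate-free [r], this is the variance of [lcomb r k] when the [X i] are independent
    with standard deviations [sd i]. *)
Definition lvar (r : seq I) (k : K) : R :=
  \sum_(i <- r) (kap i == k)%:R * (a i * sd i) ^+ 2.

Lemma lvar_ge0 r k : 0 <= lvar r k.
Proof. by apply: sumr_ge0 => i _; rewrite mulr_ge0// sqr_ge0. Qed.

Context (mX : forall i, measurable_fun setT (X i)).
Context (sd0 : forall i, 0 < sd i).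
Context (X_normal : forall i, has_normal_law P (X i) 0 (sd i)).
Context (X_indep : mutually_independent P X).

Lemma measurable_lcomb r k : measurable_fun setT (lcomb r k).
Proof.
apply: measurable_sum => i; apply: measurable_funM => //.
exact: measurable_funM.
Qed.

(** Induction on [r], with [t] generalized because integrating out a variable rescales the weight of
    its block. Weights may be negative, as long as the positivity hypothesis keeps the moment
    finite. *)
Lemma integral_expR_quadratic r (t : K -> R) : uniq r ->
  (forall k, 0 < 1 + 2 * t k * lvar r k) ->
  (\int[P]_w (expR (- \sum_k t k * lcomb r k w ^+ 2))%:E =
   (\prod_k (Num.sqrt (1 + 2 * t k * lvar r k))^-1)%:E)%E.
Proof.
elim: r t => [|i r ih] t /=.
  move=> _ _; rewrite big1; last first.
    by move=> k _; rewrite /lvar big_nil mulr0 addr0 sqrtr1 invr1.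
  under eq_integral => w _.
    rewrite big1; last by move=> k _; rewrite /lcomb big_nil expr0n/= mulr0.
    rewrite oppr0 expR0; over.
  rewrite integral_cst; last exact: measurableT.
  by rewrite mul1e; exact: probability_setT.
move=> /andP[ir ur] tV; set k0 := kap i; set v := (a i * sd i) ^+ 2.
have lvarS k : lvar (i :: r) k = (k0 == k)%:R * v + lvar r k.
  by rewrite /lvar big_cons.
have lcombS k w : lcomb (i :: r) k w = (k0 == k)%:R * (a i * X i w) + lcomb r k w.
  by rewrite /lcomb big_cons.
have v0 : 0 <= v by exact: sqr_ge0.
(* The hypothesis controls only the total variance of the block. For a negative weight, dropping the
   variance coming from [r] can only increase the quantity; for a nonnegative weight it is at least
   1. *)
have q0 : 0 < 1 + 2 * t k0 * v.
  have := tV k0; rewrite lvarS eqxx mul1r; have := lvar_ge0 r k0.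
  have [t0|t0] := lerP 0 (t k0); first by move=> *; nra.
  move=> l0 h; apply: (lt_le_trans h).
  by rewrite lerD2l mulrDr gerDl mulr_le0_ge0// mulr_ge0_le0// ltW.
set q := 1 + 2 * t k0 * v in q0.
pose t' k := if k == k0 then t k0 / q else t k.
(* The factor of block [k0] is divided by [q]: positivity survives, and the two square roots
   multiply back to the original factor. *)
have t'V k : 1 + 2 * t' k * lvar r k =
    if k == k0 then (1 + 2 * t k0 * lvar (i :: r) k0) / q
    else 1 + 2 * t k * lvar (i :: r) k.
  rewrite /t' !lvarS eqxx; case: eqP => [->|]; last first.
    by rewrite [k0 == k]eq_sym => /eqP/negbTE ->; rewrite mul0r add0r.
  by rewrite mul1r /q; field; rewrite -/q gt_eqF.
pose U w := expR (- \sum_(k | k != k0) t k * lcomb r k w ^+ 2).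
transitivity (\int[P]_w (expR (- (t k0 * (a i * X i w + lcomb r k0 w) ^+ 2)) * U w)%:E)%E.
  apply: eq_integral => w _; rewrite (bigD1 k0)//= lcombS eqxx mul1r opprD expRD.
  congr (_ * expR (- _))%:E; apply: eq_bigr => k kk0.
  by rewrite lcombS [k0 == k]eq_sym (negbTE kk0) mul0r add0r.
(* Stated over an arbitrary space, since it serves both on [T] and on the sigma-algebra generated by
   the variables in [r]. *)
have mU d (T' : measurableType d) (L : K -> T' -> R) :
    (forall k, measurable_fun setT (L k)) ->
    measurable_fun setT (fun w => expR (- \sum_(k | k != k0) t k * L k w ^+ 2)).
  move=> mL; apply: measurableT_comp => //; apply: measurableT_comp => //.
  under eq_fun do rewrite big_mkcond/=.
  apply: measurable_sum => k; case: (k != k0) => //.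
  by apply: measurable_funM => //; exact: measurable_funX.
rewrite (@integral_integrate_out _ _ _ _ _ _ _ (sd i))//; first last.
- move=> A B mA mB; rewrite -X_normal//.
  apply: (@mutually_independent_cylinders _ _ _ _ _ _ [set j | j \in r]%SET) => //.
    by rewrite inE.
  (* The forms must be measurable for the variables in [r] alone, from which [X i] is independent.
     Guarding each term by [j \in r] makes every summand visibly so. *)
  have mLr k : measurable_fun setT
      (lcomb r k : g_sigma_algebraType (cylinders X [set j | j \in r]%SET) -> R).
    rewrite (_ : lcomb r k = fun w => \sum_(j <- r)
        if j \in r then (kap j == k)%:R * (a j * X j w) else 0); last first.
      by apply/funext => w; rewrite /lcomb big_seq [LHS]big_mkcond.
    apply: measurable_sum => j; case: (boolP (j \in r)) => // jr.
    apply: measurable_funM => //; apply: measurable_funM => //.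
    by apply: measurable_fun_cylinders; rewrite inE.
  rewrite -[_ @^-1` _]setTI.
  exact: (measurable_fun_pair (mLr k0) (mU _ _ _ mLr)).
- by move=> w; exact: expR_ge0.
- by apply: mU => k; exact: measurable_lcomb.
- exact: measurable_lcomb.
rewrite -/v -/q.
transitivity (((Num.sqrt q)^-1)%:E *
    \int[P]_w (expR (- \sum_k t' k * lcomb r k w ^+ 2))%:E)%E.
  congr (_ * _)%E; apply: eq_integral => w _; rewrite [in RHS](bigD1 k0)//=.
  rewrite opprD expRD {1}/t' eqxx; congr (_ * expR (- _))%:E.
  by apply: eq_bigr => k kk0; rewrite /t' (negbTE kk0).
rewrite ih//; last first.
  by move=> k; rewrite t'V; case: eqP => // _; rewrite divr_gt0.
rewrite -EFinM (bigD1 k0)//= [in RHS](bigD1 k0)//= mulrA; congr (_ * _)%:E.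
  rewrite t'V eqxx sqrtrM ?ltW// sqrtrV ?ltW// invfM invrK mulrCA mulVf ?mulr1//.
  by rewrite gt_eqF// sqrtr_gt0.
by apply: eq_bigr => k kk0; rewrite t'V (negbTE kk0).
Qed.

End quadratic_forms.

(** * Comparison of two quadratic forms *)

(** The indicator of the event is at most [expR (s * SB) * expR (- (s * SA))]. The two factors may
    be dependent, so their product is bounded by a combination of their squares. *)
Lemma prob_lt_expR (dT : measure_display) (T : measurableType dT)
  (R : realType) (P : probability T R) (SA SB : T -> R) (s p q : R) :
  measurable_fun setT SA -> measurable_fun setT SB -> 0 < s -> 0 < p -> 0 < q ->
  (\int[P]_w (expR (2 * s * SB w))%:E <= p%:E)%E ->
  (\int[P]_w (expR (- (2 * s * SA w)))%:E <= q%:E)%E ->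
  (P [set w | (SA w < SB w)%R] <= (Num.sqrt (p * q))%:E)%E.
Proof.
move=> mA mB s0 p0 q0 Bp Aq.
have sp : 0 < Num.sqrt p by rewrite sqrtr_gt0.
have sq : 0 < Num.sqrt q by rewrite sqrtr_gt0.
(* Weighted AM-GM, balanced so that both exponential moments contribute equally,
   plays the role of Cauchy-Schwarz. *)
pose l := Num.sqrt q / Num.sqrt p.
have l0 : 0 < l by rewrite divr_gt0.
have c1 : 0 <= l / 2 by rewrite divr_ge0// ltW.
have c2 : 0 <= (2 * l)^-1 by rewrite invr_ge0 mulr_ge0// ltW.
have mE : measurable [set w | SA w < SB w].
  have := measurable_fun_ltr mA mB measurableT (Y := [set true]).
  by rewrite setTI; apply.
have mu1 : measurable_fun setT (fun w => (expR (2 * s * SB w))%:E).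
  apply/measurable_EFinP; apply: measurableT_comp => //.
  exact: measurable_funM.
have mu2 : measurable_fun setT (fun w => (expR (- (2 * s * SA w)))%:E).
  apply/measurable_EFinP; apply: measurableT_comp => //.
  by apply: measurableT_comp => //; exact: measurable_funM.
apply: (@le_trans _ _ (\int[P]_w ((l / 2)%:E * (expR (2 * s * SB w))%:E
    + ((2 * l)^-1)%:E * (expR (- (2 * s * SA w)))%:E)))%E; last first.
  rewrite ge0_integralD//; last 4 first.
  - by move=> w _; rewrite -EFinM lee_fin mulr_ge0 ?expR_ge0.
  - exact: measurable_funeM.
  - by move=> w _; rewrite -EFinM lee_fin mulr_ge0 ?expR_ge0.
  - exact: measurable_funeM.
  rewrite !ge0_integralZl ?lee_fin//.
  apply: (@le_trans _ _ ((l / 2)%:E * p%:E + ((2 * l)^-1)%:E * q%:E)%E).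
    by apply: leeD; apply: lee_wpmul2l; rewrite ?lee_fin.
  have balance (x y : R) : 0 < x -> 0 < y ->
      y / x / 2 * x ^+ 2 + (2 * (y / x))^-1 * y ^+ 2 = x * y.
    by move=> x0 y0; field; rewrite !gt_eqF.
  have := balance _ _ sp sq; rewrite !sqr_sqrtr ?(ltW p0) ?(ltW q0)// => lE.
  by rewrite -!EFinM -EFinD lee_fin sqrtrM ?(ltW p0)// -lE.
have -> : P [set w | (SA w < SB w)%R] = (\int[P]_w (\1_[set w | (SA w < SB w)%R] w)%:E)%E.
  by rewrite integral_indic// setIT.
apply: ge0_le_integral => //=.
- exact/measurable_EFinP/measurable_indic.
- by apply: emeasurable_funD; apply: measurable_funeM.
move=> w _; rewrite -!EFinM -EFinD lee_fin indicE.
set u := expR (s * SB w); set v := expR (- (s * SA w)).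
have -> : expR (2 * s * SB w) = u ^+ 2 by rewrite -expRM_natl mulrA.
have -> : expR (- (2 * s * SA w)) = v ^+ 2 by rewrite -expRM_natl mulrN mulrA.
apply: (@le_trans _ _ (u * v)).
  case: (boolP (w \in _)) => [|_]; last by rewrite mulr_ge0 ?expR_ge0.
  rewrite inE /= => ABw; rewrite -expRD -[leLHS]expR0 ler_expR -mulrBr.
  by rewrite mulr_ge0 ?ltW// subr_gt0.
rewrite -subr_ge0.
have -> : l / 2 * u ^+ 2 + (2 * l)^-1 * v ^+ 2 - u * v =
    (l * u - v) ^+ 2 / (2 * l).
  by field; rewrite gt_eqF.
by rewrite divr_ge0 ?sqr_ge0// ltW// mulr_gt0.
Qed.

(** Each of the [d] coordinates brings an inverse square root and the Cauchy-Schwarz step one more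
    square root, hence the exponent [d / 4]. *)
Lemma sqrt_prod_powR (R : realType) (x y : R) (d : nat) : 0 < x -> 0 < y ->
  Num.sqrt ((Num.sqrt x)^-1 ^+ d * (Num.sqrt y)^-1 ^+ d) =
  (x * y)^-1 `^ (d%:R / 4).
Proof.
move=> x0 y0; rewrite -exprMn -invfM -sqrtrM ?ltW//.
have xy0 : 0 <= (x * y)^-1 by rewrite invr_ge0 mulr_ge0// ltW.
rewrite -sqrtrV ?mulr_ge0 ?ltW// -!powR12_sqrt ?exprn_ge0 ?sqrtr_ge0 ?powR_ge0//.
rewrite -powR_mulrn ?powR_ge0// -!powRrM; by congr (_ `^ _); field.
Qed.

Section quadratic_forms_comparison.
Context {dT : measure_display} {T : measurableType dT} {R : realType}.
Context (P : probability T R) {I K : finType} (X : I -> T -> R).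
Context (sd : I -> R) (kap : I -> K).
Context (mX : forall i, measurable_fun setT (X i)).
Context (sd0 : forall i, 0 < sd i).
Context (X_normal : forall i, has_normal_law P (X i) 0 (sd i)).
Context (X_indep : mutually_independent P X).

Lemma prob_quadratic_lt (a b : I -> R) (VA VB : R) : 0 <= VB -> VB < VA ->
  (forall k, VA <= lvar a sd kap (index_enum I) k) ->
  (forall k, lvar b sd kap (index_enum I) k <= VB) ->
  (P [set w | (\sum_k lcomb X a kap (index_enum I) k w ^+ 2 <
      \sum_k lcomb X b kap (index_enum I) k w ^+ 2)%R] <=
    ((4 * VA * VB / (VA + VB) ^+ 2) `^ (#|K|%:R / 4))%:E)%E.
Proof.
move=> VB0 VBA VAa bVB.
have VA0 : 0 < VA by exact: le_lt_trans VBA.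
(* The optimal [s] divides by [VB]. When [VB = 0], as for a singleton cluster, all the [b i] vanish
   and the event is empty. *)
have [VB_eq0|VB_neq0] := eqVneq VB 0.
  have b0 i : b i = 0.
    have := bVB (kap i); rewrite VB_eq0 => lv0.
    have /eqP : lvar b sd kap (index_enum I) (kap i) = 0.
      by apply/eqP; rewrite eq_le lv0 lvar_ge0.
    rewrite /lvar psumr_eq0; last by move=> j _; rewrite mulr_ge0// sqr_ge0.
    move=> /allP/(_ i (mem_index_enum i)) /=.
    by rewrite eqxx mul1r expf_eq0/= mulf_eq0 (gt_eqF (sd0 i)) orbF => /eqP.
  rewrite (_ : [set w | _] = set0) ?measure0 ?lee_fin ?powR_ge0//.
  apply/seteqP; split => // w /=; rewrite [ltRHS]big1; last first.
    move=> k _; rewrite /lcomb big1 ?expr0n// => j _.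
    by rewrite b0 mul0r mulr0.
  by rewrite ltNge sumr_ge0// => k _; exact: sqr_ge0.
have {VB_neq0}VB_gt0 : 0 < VB by rewrite lt_def VB_neq0.
(* [4 s] maximises [(1 - x VB) (1 + x VA)] over [x]. *)
pose s := (VA - VB) / (8 * VA * VB).
have s0 : 0 < s by rewrite divr_gt0 ?subr_gt0// !mulr_gt0.
have alE : 1 - 4 * s * VB = (VA + VB) / (2 * VA).
  by rewrite /s; field; rewrite !gt_eqF.
have beE : 1 + 4 * s * VA = (VA + VB) / (2 * VB).
  by rewrite /s; field; rewrite !gt_eqF.
have al0 : 0 < 1 - 4 * s * VB by rewrite alE divr_gt0 ?addr_gt0 ?mulr_gt0.
have be0 : 0 < 1 + 4 * s * VA by rewrite beE divr_gt0 ?addr_gt0 ?mulr_gt0.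
have rhoE : 4 * VA * VB / (VA + VB) ^+ 2 =
    ((1 - 4 * s * VB) * (1 + 4 * s * VA))^-1.
  by rewrite alE beE; field; rewrite !gt_eqF ?addr_gt0.
rewrite rhoE -sqrt_prod_powR//.
have mq c : measurable_fun setT
    (fun w => \sum_k lcomb X c kap (index_enum I) k w ^+ 2).
  by apply: measurable_sum => k; apply: measurable_funX; exact: measurable_lcomb.
have sqrtV_gt0 x : 0 < x -> 0 < (Num.sqrt x)^-1 :> R.
  by move=> x0; rewrite invr_gt0 sqrtr_gt0.
apply: (@prob_lt_expR _ _ _ _ _ _ s) => //; try by apply: exprn_gt0; exact: sqrtV_gt0.
(* With the negative weight [- (2 * s)] the moment grows with the variance, so the upper bound [VB]
   is the worst case, and [al0] keeps it finite. *)
- have Vb k : 1 - 4 * s * VB <= 1 + 2 * - (2 * s) * lvar b sd kap (index_enum I) k.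
    have := ler_wpM2l (ltW s0) (bVB k); lra.
  under eq_integral => w _.
    have -> : 2 * s * \sum_k lcomb X b kap (index_enum I) k w ^+ 2 =
        - \sum_k - (2 * s) * lcomb X b kap (index_enum I) k w ^+ 2.
      by rewrite -mulr_sumr mulNr opprK.
    over.
  rewrite (@integral_expR_quadratic _ _ _ _ _ _ _ _ sd _ _ _ _ _ _ (fun=> - (2 * s)))//.
  + rewrite lee_fin -prodr_const; apply: ler_prod => k _.
    rewrite ltW ?sqrtV_gt0//=; last exact: lt_le_trans (Vb k).
    rewrite lef_pV2 ?posrE ?sqrtr_gt0//; last exact: lt_le_trans (Vb k).
    exact: ler_wsqrtr.
  + exact: index_enum_uniq.
  + by move=> k; exact: lt_le_trans (Vb k).
(* With a positive weight the moment decreases with the variance, so the worst case is the lower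
   bound [VA]. *)
- have Va k : 1 + 4 * s * VA <= 1 + 2 * (2 * s) * lvar a sd kap (index_enum I) k.
    have := ler_wpM2l (ltW s0) (VAa k); lra.
  under eq_integral => w _ do rewrite mulr_sumr.
  rewrite (@integral_expR_quadratic _ _ _ _ _ _ _ _ sd _ _ _ _ _ _ (fun=> 2 * s))//.
  + rewrite lee_fin -prodr_const; apply: ler_prod => k _.
    rewrite ltW ?sqrtV_gt0//=; last exact: lt_le_trans (Va k).
    rewrite lef_pV2 ?posrE ?sqrtr_gt0//; last exact: lt_le_trans (Va k).
    exact: ler_wsqrtr.
  + exact: index_enum_uniq.
  + by move=> k; exact: lt_le_trans (Va k).
Qed.

End quadratic_forms_comparison.

(** * Deviation of a point from a centroid *)

(** Plays the role of [kap]: each scalar Gaussian, from a center ([inl]) or a noise vector ([inr]),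
    enters only the form of its own coordinate. *)
Definition coordinate {L M D : Type} (s : (L * D) + (M * D)) : D :=
  match s with inl (_, k) | inr (_, k) => k end.

Lemma sum_coordinate (R : nzSemiRingType) (L M D : finType)
  (F : (L * D) + (M * D) -> R) (k : D) :
  \sum_s (coordinate s == k)%:R * F s =
  \sum_l F (inl (l, k)) + \sum_m F (inr (m, k)).
Proof.
have sum_pair (N : finType) (G : N * D -> R) :
    \sum_p (p.2 == k)%:R * G p = \sum_l G (l, k).
  rewrite (eq_bigr (fun p => (p.2 == k)%:R * G (p.1, p.2))); last by case.
  rewrite -(pair_bigA _ (fun l k' => (k' == k)%:R * G (l, k'))) /=.
  apply: eq_bigr => l _; rewrite (bigD1 k)//= eqxx mul1r big1 ?addr0//.
  by move=> k' /negbTE ->; rewrite mul0r.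
rewrite big_sumType /= -(sum_pair _ (F \o inl)) -(sum_pair _ (F \o inr)).
by congr (_ + _); apply: eq_bigr => -[].
Qed.

Lemma sum_delta (R : nzSemiRingType) (L : finType) (l0 : L) (F : L -> R) :
  \sum_l (l0 == l)%:R * F l = F l0.
Proof.
rewrite (bigD1 l0)//= eqxx mul1r big1 ?addr0// => l.
by rewrite eq_sym => /negbTE ->; rewrite mul0r.
Qed.

Section deviation_from_centroid.
Context {R : realType} {n d : nat} (z C : 'I_n -> 'I_2) (i : 'I_n).

Definition csize (j : 'I_2) : R := #|[pred m | C m == j]|%:R.

(** Coefficient of center [l], and in [noise_coef] that of noise [m], in the difference between
    point [i] and the centroid of cluster [j]; it is the same in every coordinate. *)
Definition mean_coef (j l : 'I_2) : R :=
  (z i == l)%:R - (csize j)^-1 * \sum_(m | C m == j) (z m == l)%:R.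

Definition noise_coef (j : 'I_2) (m : 'I_n) : R :=
  (i == m)%:R - (csize j)^-1 * (C m == j)%:R.

Definition dev_coef (j : 'I_2) (s : ('I_2 * 'I_d) + ('I_n * 'I_d)) : R :=
  match s with inl (l, _) => mean_coef j l | inr (m, _) => noise_coef j m end.

Lemma centroid_deviation (j : 'I_2) (mu : 'I_2 -> 'I_d -> R)
  (xi : 'I_n -> 'I_d -> R) (k : 'I_d) :
  mu (z i) k + xi i k - centroid C j (fun m k => mu (z m) k + xi m k) k =
  \sum_s (coordinate s == k)%:R *
    (dev_coef j s * match s with inl (l, k') => mu l k' | inr (m, k') => xi m k' end).
Proof.
rewrite sum_coordinate /= /centroid -/(csize j) big_split mulrDr opprD addrACA.
congr (_ + _).
- rewrite /mean_coef; under [RHS]eq_bigr do rewrite mulrBl.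
  rewrite sumrB sum_delta; congr (_ - _).
  under [RHS]eq_bigr do rewrite -mulrA; rewrite -mulr_sumr; congr (_ * _).
  under [RHS]eq_bigr do rewrite mulr_suml.
  by rewrite exchange_big/=; apply: eq_bigr => m _; rewrite sum_delta.
- rewrite /noise_coef; under [RHS]eq_bigr do rewrite mulrBl.
  rewrite sumrB sum_delta; congr (_ - _).
  under [RHS]eq_bigr do rewrite -mulrA; rewrite -mulr_sumr; congr (_ * _).
  rewrite big_mkcond; apply: eq_bigr => m _.
  by case: eqP; rewrite ?mul1r ?mul0r.
Qed.

Lemma sum_csize j : \sum_(m | C m == j) 1 = csize j :> R.
Proof. by rewrite sumr_const. Qed.

(** The cross term of the square is present only if [i] lies in cluster [j]: the sum is [1 - 1/c]
    for its own cluster and [1 + 1/cb] for the other. *)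
Lemma sum_noise_coef_sqr j : csize j != 0 ->
  \sum_m noise_coef j m ^+ 2 = 1 + (csize j)^-1 - 2 * (csize j)^-1 * (C i == j)%:R.
Proof.
move=> c0.
under eq_bigr => m _.
  rewrite (_ : _ ^+ 2 = (i == m)%:R * (1 - 2 * (csize j)^-1 * (C m == j)%:R)
    + (csize j)^-1 ^+ 2 * (C m == j)%:R); last first.
    by rewrite /noise_coef; case: (i == m); case: (C m == j) => /=; ring.
  over.
rewrite big_split/= sum_delta -mulr_sumr.
have -> : \sum_m (C m == j)%:R = csize j :> R.
  by rewrite -sum_csize [RHS]big_mkcond; apply: eq_bigr => m _; case: eqP.
by field.
Qed.

Lemma csize_own_ge1 : 1 <= csize (C i).
Proof. by rewrite ler1n; apply/card_gt0P; exists i; rewrite inE. Qed.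

(** Point [i] counts in its own centroid with its own label, so each coefficient is [1 - 1/c] or 0,
    minus [N / c] with [0 <= N <= c - 1]. Its absolute value is thus at most [1 - 1/c], and there
    are two labels. *)
Lemma sum_mean_coef_sqr_le :
  \sum_l mean_coef (C i) l ^+ 2 <= 2 * (1 - (csize (C i))^-1) ^+ 2.
Proof.
have c1 := csize_own_ge1; set c := csize (C i) in c1 *.
have c0 : 0 < c by exact: lt_le_trans c1.
apply: (@le_trans _ _ (\sum_(l : 'I_2) (1 - c^-1) ^+ 2)); last first.
  by rewrite sumr_const card_ord mulr_natl.
apply: ler_sum => l _.
rewrite /mean_coef -/c (bigD1 i)//=; set N := \sum_(m | _) _.
have N0 : 0 <= N by exact: sumr_ge0.
have Nc : N <= c - 1.
  rewrite /c -sum_csize (bigD1 i)//= addrAC subrr add0r.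
  by apply: ler_sum => m _; case: eqP.
have N'0 : 0 <= c^-1 * N by rewrite mulr_ge0// invr_ge0 ltW.
have N'c : c^-1 * N <= 1 - c^-1.
  have -> : 1 - c^-1 = c^-1 * (c - 1) by field; rewrite gt_eqF.
  by rewrite ler_wpM2l// invr_ge0 ltW.
rewrite mulrDr; move: N'0 N'c; set N' := c^-1 * N; move=> N'0 N'c.
case: (z i == l) => /=; rewrite ?mulr1 ?mulr0; nra.
Qed.

Lemma lvar_dev_coef (tau sigma : R) j k :
  lvar (dev_coef j) (fun s => match s with inl _ => tau | inr _ => sigma end)
    coordinate (index_enum _) k =
  tau ^+ 2 * \sum_l mean_coef j l ^+ 2 + sigma ^+ 2 * \sum_m noise_coef j m ^+ 2.
Proof.
rewrite /lvar sum_coordinate /= !mulr_sumr.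
by congr (_ + _); apply: eq_bigr => l _; rewrite exprMn mulrC.
Qed.

End deviation_from_centroid.

(** * The closed form of [rho34] and the final bound *)

(** Scaling numerator and denominator of the right-hand side by [(c ^+ 2 * cb) ^+ 2] clears the
    inverses and yields the polynomials of [rho34]. *)
Lemma rho34E (R : realType) (sigma tau c cb : R) :
  c != 0 -> cb != 0 ->
  let VA := sigma ^+ 2 * (1 + cb^-1) in
  let VB := 2 * tau ^+ 2 * (1 - c^-1) ^+ 2 + sigma ^+ 2 * (1 - c^-1) in
  VA + VB != 0 ->
  rho34 sigma tau c cb = 4 * VA * VB / (VA + VB) ^+ 2.
Proof.
move=> c0 cb0 VA VB VAB.
have den : - c * (sigma ^+ 2 + 4 * tau ^+ 2) * cb
     + c ^+ 2 * (sigma ^+ 2 + 2 * (sigma ^+ 2 + tau ^+ 2) * cb)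
     + 2 * tau ^+ 2 * cb = c ^+ 2 * cb * (VA + VB).
  by rewrite /VA /VB; field; rewrite c0 cb0.
have num : 4 * sigma ^+ 2 * (c - 1) * c ^+ 2 * cb * (cb + 1)
     * (c * (sigma ^+ 2 + 2 * tau ^+ 2) - 2 * tau ^+ 2) =
     (c ^+ 2 * cb) ^+ 2 * (4 * VA * VB).
  by rewrite /VA /VB; field; rewrite c0 cb0.
rewrite /rho34 den num; field.
by rewrite VAB c0 cb0.
Qed.

Theorem theorem3p4 (R : realType) (dT : measure_display) (T : measurableType dT)
  (P : probability T R) (n d : nat) (tau sigma : R)
  (mu : 'I_2 -> 'I_d -> T -> R) (xi : 'I_n -> 'I_d -> T -> R)
  (z C : 'I_n -> 'I_2) (i : 'I_n) :
  (2 <= n)%N -> (1 <= d)%N -> 0 < tau -> 0 < sigma ->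
  (forall l k, measurable_fun setT (mu l k)) ->
  (forall m k, measurable_fun setT (xi m k)) ->
  (forall l k, has_normal_law P (mu l k) 0 tau) ->
  (forall m k, has_normal_law P (xi m k) 0 sigma) ->
  mutually_independent P
    (fun s : ('I_2 * 'I_d) + ('I_n * 'I_d) =>
       match s with inl (l, k) => mu l k | inr (m, k) => xi m k end) ->
  (forall l : 'I_2, exists m, z m = l) ->
  (forall l : 'I_2, exists m, C m = l) ->
  let x : T -> 'I_n -> 'I_d -> R := fun w m k => mu (z m) k w + xi m k w in
  let j := C i in
  let jb := other j in
  let c : R := #|[pred m | C m == j]|%:R in
  let cb : R := #|[pred m | C m == jb]|%:R in
  sigma > Num.sqrt (2 * cb) * tau * (c - 1) / Num.sqrt (c * (c + cb)) ->
  (P [set w | (sqdist (x w i) (centroid C jb (x w)) < sqdist (x w i) (centroid C j (x w)))%R]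
    <= ((rho34 sigma tau c cb) `^ (d%:R / 4))%:E)%E
  /\ 0 <= rho34 sigma tau c cb < 1.
Proof.
move=> _ _ tau0 sigma0 mmu mxi mu_normal xi_normal indep _ C_surj x j jb c cb sep.
have c1 : 1 <= c by exact: csize_own_ge1.
have c0 : 0 < c by exact: lt_le_trans c1.
have cb0 : 0 < cb.
  by rewrite ltr0n; apply/card_gt0P; have [m Cm] := C_surj jb; exists m; rewrite inE Cm.
have jbj : (C i == jb) = false.
  by rewrite /jb /j /other; case: (C i) => -[|[|[]]].
(* Both sides are nonnegative because [c >= 1], so the hypothesis can be squared; the result is
   [VB < VA] with denominators cleared. *)
have {}sep : 2 * cb * (tau * (c - 1)) ^+ 2 < sigma ^+ 2 * (c * (c + cb)).
  move: sep; rewrite ltr_pdivrMr; last by rewrite sqrtr_gt0 mulr_gt0// addr_gt0.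
  rewrite -mulrA -ltr_sqr ?nnegrE; last 2 first.
  - by rewrite mulr_ge0 ?sqrtr_ge0 ?mulr_ge0 ?subr_ge0// ltW.
  - by rewrite mulr_ge0 ?sqrtr_ge0// ltW.
  by rewrite !exprMn !sqr_sqrtr ?mulr_ge0 ?addr_ge0// ltW.
pose VA := sigma ^+ 2 * (1 + cb^-1).
pose VB := 2 * tau ^+ 2 * (1 - c^-1) ^+ 2 + sigma ^+ 2 * (1 - c^-1).
have cV : 0 <= 1 - c^-1 by rewrite subr_ge0 invf_le1.
have VB0 : 0 <= VB.
  by rewrite addr_ge0// mulr_ge0 ?sqr_ge0// mulr_ge0 ?sqr_ge0.
have VBA : VB < VA.
  rewrite -subr_gt0 (_ : VA - VB = (sigma ^+ 2 * (c * (c + cb)) -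
    2 * cb * (tau * (c - 1)) ^+ 2) / (c ^+ 2 * cb)).
    by rewrite divr_gt0 ?subr_gt0// mulr_gt0// exprn_gt0.
  by rewrite /VA /VB; field; rewrite !gt_eqF.
have VA0 : 0 < VA by exact: le_lt_trans VBA.
have VAB : 0 < VA + VB by rewrite ltr_wpDr.
rewrite rho34E -/VA -/VB ?gt_eqF//; split; last first.
  apply/andP; split.
    by apply: divr_ge0; [do 2?apply: mulr_ge0 => //; exact: ltW|exact: sqr_ge0].
  (* Strict AM-GM: [(VA + VB) ^+ 2 - 4 * VA * VB] is the square of [VA - VB], which is nonzero. *)
  rewrite ltr_pdivrMr ?exprn_gt0// mul1r -subr_gt0.
  rewrite (_ : _ - _ = (VA - VB) ^+ 2); last by ring.
  by rewrite exprn_gt0 ?subr_gt0.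
set X := (X in mutually_independent P X) in indep.
pose sd (s : ('I_2 * 'I_d) + ('I_n * 'I_d)) :=
  match s with inl _ => tau | inr _ => sigma end.
have mX s : measurable_fun setT (X s) by case: s => -[].
have sd0 s : 0 < sd s by case: s.
have X_normal s : has_normal_law P (X s) 0 (sd s) by case: s => -[].
have sqdistE w j' : sqdist (x w i) (centroid C j' (x w)) =
    \sum_k lcomb X (dev_coef z C i j') coordinate (index_enum _) k w ^+ 2.
  apply: eq_bigr => k _; congr (_ ^+ 2).
  rewrite (centroid_deviation z C i j' (fun l k => mu l k w) (fun m k => xi m k w)).
  by apply: eq_bigr => -[[l k']|[m k']] _.
pose Q j' w := \sum_k lcomb X (dev_coef z C i j') coordinate (index_enum _) k w ^+ 2.
rewrite [X in P X](_ : _ = [set w | (Q jb w < Q j w)%R]); last first.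
  by apply/funext => w; rewrite /= !sqdistE.
rewrite -[in X in (X%:R / 4)](card_ord d).
apply: (prob_quadratic_lt P X sd coordinate mX sd0 X_normal indep _ _ _ _ VB0 VBA) => k;
  rewrite lvar_dev_coef sum_noise_coef_sqr; try by rewrite gt_eqF.
(* Point [i] is outside cluster [jb], so the noise alone contributes exactly [VA] and the centers
   add a nonnegative amount. *)
- rewrite jbj mulr0 subr0 lerDr mulr_ge0 ?sqr_ge0//.
  by apply: sumr_ge0 => l _; exact: sqr_ge0.
- rewrite eqxx mulr1 /VB [2 * _ ^+ 2]mulrC -[_ * 2 * _]mulrA lerD//.
    by rewrite ler_wpM2l ?sqr_ge0// sum_mean_coef_sqr_le.
  by rewrite ler_wpM2l ?sqr_ge0// -[csize C j]/c; lra.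
Qed.
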